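(* Let $m\in\mathbb{N}$ and $-1<\alpha<0$. As $k\to\infty$ ($k\in\mathbb{N}$): (a) the exceptional (i.e. the $m$ negative) roots of $L_{m,m+k}^{\mathrm{III},\alpha}(x)$ converge to the roots of $L_m^{-\alpha-1}(-x)$; that is, listing the $m$ negative roots of $L_{m,m+k}^{\mathrm{III},\alpha}(x)$ and the $m$ roots of $L_m^{-\alpha-1}(-x)$ each in increasing order, for each $i\in\{1,\dots,m\}$ the $i$-th root of the former converges to the $i$-th root of the latter; (b) the first (smallest) positive root of $L_{m,m+k}^{\mathrm{III},\alpha}(x)$ tends to zero.
   Context: $\mathbb{N}=\{1,2,\dots\}$. For $a\in\mathbb{R}$ and integer $n\ge0$ the classical Laguerre polynomial is $L_n^a(x)=\sum_{j=0}^n\binom{n+a}{n-j}\frac{(-x)^j}{j!}$, with $\binom{r}{i}=r(r-1)\cdots(r-i+1)/i!$; $L_n^a:=0$ for $n<0$. The Type III exceptional $X_m$-Laguerre polynomials are $L_{m,0}^{\mathrm{III},\alpha}(x)=1$ and, for $n\ge m+1$, $$L_{m,n}^{\mathrm{III},\alpha}(x)=xL_{n-m-2}^{\alpha+2}(x)L_m^{-\alpha-1}(-x)+(m+1)L_{n-m-1}^{\alpha+1}(x)L_{m+1}^{-\alpha-2}(-x).$$ For $-1<\alpha<0$, $L_{m,m+k}^{\mathrm{III},\alpha}(x)$ has exactly $k$ positive and $m$ negative roots, all simple; the $m$ negative ones are called its exceptional roots. The polynomial $L_m^{-\alpha-1}(-x)$ has $m$ simple roots, all negative. *)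

(* Defs.v *)
From HB Require Import structures.
From mathcomp Require Import all_boot all_order all_algebra.
From mathcomp Require Import polyrcf.
From mathcomp Require Import all_classical all_reals all_analysis.

Set Implicit Arguments.
Unset Strict Implicit.
Unset Printing Implicit Defensive.

Import Order.TTheory GRing.Theory Num.Theory.
Import numFieldNormedType.Exports.

Local Open Scope ring_scope.

Definition gbinom (R : realType) (r : R) (i : nat) : R :=
  (\prod_(j < i) (r - j%:R)) / i`!%:R.

(* The degree is an integer because the exceptional polynomials below use
   L_{-1} = 0. *)
Definition laguerre (R : realType) (a : R) (n : int) : {poly R} :=
  match n with
  | Posz d =>
      \sum_(j < d.+1) (gbinom (d%:R + a) (d - j)%N / j`!%:R) *: (- 'X) ^+ j
  | Negz _ => 0
  end.

(* Meaningful for n = 0 and n >= m + 1 only; for 1 <= n <= m the formula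
   returns the junk value 0. *)
Definition xlaguerre3 (R : realType) (alpha : R) (m n : nat) : {poly R} :=
  if n == 0%N then 1 else
    'X * laguerre (alpha + 2) (n%:Z - m%:Z - 2)
       * (laguerre (- alpha - 1) m \Po (- 'X))
    + (m.+1)%:R *: (laguerre (alpha + 1) (n%:Z - m%:Z - 1)
       * (laguerre (- alpha - 2) m.+1 \Po (- 'X))).

(* [rootsR p] is the strictly increasing list of the distinct real roots of
   p <> 0, so the two lists below are strictly increasing as well. *)
Definition neg_roots (R : realType) (p : {poly R}) : seq R :=
  [seq x <- rootsR p | x < 0].

Definition pos_roots (R : realType) (p : {poly R}) : seq R :=
  [seq x <- rootsR p | 0 < x].

(* Main.v *)
Require Import Defs.
From HB Require Import structures.
From mathcomp Require Import all_boot all_order all_algebra.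
From mathcomp Require Import polyrcf.
From mathcomp Require Import all_classical all_reals all_analysis.
From mathcomp Require Import zify ring lra.

(** Write b = - alpha - 1, so that -1 < b < 0, let Q(x) = L_m^b(-x), and for
    n = k - 1 let L = L_n^(alpha + 1). Everything rests on the formula
      P_k = x (L Q' - L' Q) + (b + x) L Q,
    a consequence of the two first-order relations between L_(n+1)^a and
    L_n^(a+1) ([laguerre_deriv], [laguerre_raise], [xlaguerre3E]).

    Counting roots is done by sign changes. At a root x of L one reads off
    P_k(x) = - x L'(x) Q(x), at a root xi of Q one reads off
    P_k(xi) = xi L(xi) Q'(xi), and P_k(0) = b L(0) Q(0) < 0. The derivative of
    a polynomial with simple real roots alternates in sign along its roots, so
    P_k changes sign between consecutive roots of L, between 0 and the first
    of them, beyond the last, between consecutive roots of Q, and to the left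
    of the first. This gives k positive and m negative roots; as deg P_k is
    m + k, there are no others ([xlaguerre3_roots]). The same argument, applied
    to (n+1) L_(n+1)^a = x M' + (a + 1 - x) M with M = L_n^(a+1), shows by
    induction on n that L_n^a has n simple positive roots when a > -1
    ([laguerre_roots]).

    For the asymptotics let u = - L' / L, the sum of 1 / (x_i - x) over the
    roots x_i of L. Laguerre's inequality u' >= 0 turns the differential
    equation of L = L_n^a into n <= |x| u^2 + (a + 1 + |x|) u for x < 0, so
    u tends to infinity with n ([laguerre_logderiv_unbounded]). Hence, for
    x < 0 fixed with Q(x) <> 0, the term x u Q dominates P_k / L and P_k(x)
    eventually has the sign of x Q(x). Just to the left of a root xi of Q this
    is opposite to the sign of P_k(xi), so P_k has a root close to xi; by the
    interlacing it is the one with the same index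
    ([xlaguerre3_neg_root_near]).

    The first positive root of P_k lies below the first root x_1 of L. At 0,
    the bound x_1 u' <= u, that is, x_1 times the sum of the 1 / x_i^2 is at
    most the sum of the 1 / x_i, involves only L(0), L'(0) and L''(0), and
    gives x_1 = O(1/n) ([laguerre_first_root_le]). *)

Set Implicit Arguments.
Unset Strict Implicit.
Unset Printing Implicit Defensive.

Import Order.TTheory GRing.Theory Num.Theory.
Import numFieldNormedType.Exports.

Local Open Scope classical_set_scope.
Local Open Scope ring_scope.

(** * Coefficient identities for Laguerre polynomials *)

Lemma gbinomS (R : realType) (r : R) i :
  gbinom r i.+1 * i.+1%:R = (r - i%:R) * gbinom r i.
Proof.
rewrite /gbinom big_ord_recr /= factS natrM.
have h1 : (i`!)%:R != 0 :> R by rewrite pnatr_eq0 -lt0n fact_gt0.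
have h2 : i.+1%:R != 0 :> R by rewrite pnatr_eq0.
by field; rewrite h1 -natr1 in h2 *; rewrite addrC.
Qed.

Lemma gbinom0 (R : realType) (r : R) : gbinom r 0 = 1.
Proof. by rewrite /gbinom big_ord0 fact0 divr1. Qed.

Lemma coef_laguerre (R : realType) (a : R) (n j : nat) :
  (laguerre a n)`_j =
  if (j <= n)%N then (-1) ^+ j * gbinom (n%:R + a) (n - j) / j`!%:R else 0.
Proof.
have -> : laguerre a n =
    \poly_(j < n.+1) ((-1) ^+ j * gbinom (n%:R + a) (n - j) / j`!%:R).
  rewrite poly_def; apply: eq_bigr => i _.
  rewrite -!mul_polyC [(- 'X) ^+ i]exprNn -[(-1) ^+ i * _ / _]mulrA.
  by rewrite [((-1) ^+ i * _)%:P]polyCM polyC_exp polyCN; ring.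
by rewrite coef_poly ltnS.
Qed.

Lemma laguerre_deriv (R : realType) (a : R) (n : nat) :
  (laguerre a n.+1)^`() = - laguerre (a + 1) n.
Proof.
apply/polyP => j; rewrite coef_deriv coefN !coef_laguerre ltnS subSS.
case: ifP => _; last by rewrite mul0rn oppr0.
have h1 : (j`!)%:R != 0 :> R by rewrite pnatr_eq0 -lt0n fact_gt0.
have h2 : 1 + j%:R != 0 :> R by rewrite nat1r pnatr_eq0.
have -> : n.+1%:R + a = n%:R + (a + 1) by rewrite -natr1; ring.
by rewrite factS natrM exprS -mulr_natr -nat1r; field; rewrite h1 h2.
Qed.

(** With [laguerre_deriv], this is the differential equation of [L_(n+1)^a]
    split into two first-order steps. *)
Lemma laguerre_raise (R : realType) (a : R) (n : nat) :
  n.+1%:R *: laguerre a n.+1 =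
  'X * (laguerre (a + 1) n)^`() + ((a + 1)%:P - 'X) * laguerre (a + 1) n.
Proof.
apply/polyP => j; rewrite mulrBl !(coefD, coefN, coefZ, coefCM, coefXM).
rewrite coef_deriv !coef_laguerre.
have -> : n.+1%:R + a = n%:R + (a + 1) by rewrite -natr1; ring.
set N := _ + (a + 1).
case: j => [|j] /=.
  rewrite !subn0 fact0 expr0 !divr1 !mul1r add0r subr0 mulrC gbinomS /N; ring.
rewrite ltnS subSS.
have h1 : (j`!)%:R != 0 :> R by rewrite pnatr_eq0 -lt0n fact_gt0.
have h2 : 1 + j%:R != 0 :> R by rewrite nat1r pnatr_eq0.
case: (ltngtP j n) h1 h2 => [jn|_|->] h1 h2.
- have [d nE] : exists d, n = (j + d.+1)%N by exists (n - j).-1; lia.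
  have -> : (n - j = d.+1)%N by lia.
  have -> : (n - j.+1 = d)%N by lia.
  have h3 : 1 + d%:R != 0 :> R by rewrite nat1r pnatr_eq0.
  have nR : n%:R = j%:R + d%:R + 1 :> R by rewrite nE addnS -natr1 natrD.
  have -> : gbinom N d.+1 = (j%:R + a + 2) * gbinom N d / (1 + d%:R).
    apply: (mulIf h3); rewrite divfK // nat1r gbinomS /N nR.
    by congr (_ * _); ring.
  rewrite factS natrM exprS -mulr_natr -(nat1r n) -(nat1r j) nR.
  by field; rewrite h1 h2 h3.
- by rewrite mul0rn !mulr0 subr0 addr0.
rewrite subnn gbinom0 factS natrM exprS -(nat1r n) mul0rn.
by field; rewrite h1 h2.
Qed.

(** * Polynomials with simple real roots *)

Lemma horner_prod_XsubC_root (R : comNzRingType) (s : seq R) (c z : R) :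
  z \in s -> (c *: \prod_(y <- s) ('X - y%:P)).[z] = 0.
Proof.
move=> zs; rewrite hornerZ horner_prod (big_rem z zs) /= hornerXsubC subrr.
by rewrite mul0r mulr0.
Qed.

Lemma prod_XsubC_sgn (R : realFieldType) (s1 s2 : seq R) (x : R) :
  all (< x) s1 -> all (> x) s2 ->
  0 < (-1) ^+ size s2 * (\prod_(z <- s1 ++ s2) ('X - z%:P)).[x].
Proof.
move=> /allP lt_s1 /allP gt_s2; rewrite horner_prod big_cat /= mulrCA.
apply: mulr_gt0.
  rewrite big_seq; apply: prodr_gt0 => z /lt_s1 /= zx.
  by rewrite hornerXsubC subr_gt0.
elim: s2 gt_s2 => [|z s2 IHs] gt_s2; first by rewrite big_nil mulr1 ltr01.
rewrite big_cons exprS mulrACA hornerXsubC mulN1r opprB.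
rewrite mulr_gt0 ?subr_gt0 ?gt_s2 ?mem_head ?IHs // => y ys.
by rewrite gt_s2 // inE ys orbT.
Qed.

Lemma lt_sorted_split (R : realFieldType) (s : seq R) i :
  sorted <%R s -> (i < size s)%N ->
  all (< nth 0 s i) (take i s) /\ all (> nth 0 s i) (drop i.+1 s).
Proof.
move=> + ltis; rewrite -{1}(cat_take_drop i s) (drop_nth 0 ltis).
rewrite lt_sorted_pairwise pairwise_cat allrel_consr pairwise_cons.
by case/and3P => /andP[-> _] _ /andP[].
Qed.

(** At a root the derivative is the product of the other factors, so its sign
    is read off from the number of roots to the right. *)
Lemma deriv_prod_XsubC_sgn (R : realFieldType) (s : seq R) i :
  sorted <%R s -> (i < size s)%N ->
  0 < (-1) ^+ (size s - i.+1) *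
      ((\prod_(z <- s) ('X - z%:P))^`()).[nth 0 s i].
Proof.
move=> s_sorted ltis; have [lts gts] := lt_sorted_split s_sorted ltis.
have := prod_XsubC_sgn lts gts; rewrite size_drop big_cat /=.
set x := nth 0 s i; set p1 := \prod_(z <- take _ _) _.
set p2 := \prod_(z <- drop _ _) _.
rewrite -{3}(cat_take_drop i s) (drop_nth 0 ltis) big_cat big_cons /=.
rewrite -/p1 -/p2 -/x mulrCA derivM derivXsubC mul1r.
by rewrite hornerD [X in _ + X]hornerM hornerXsubC subrr mul0r addr0.
Qed.

Lemma alternating_roots (R : rcfType) (f : {poly R}) (t : nat -> R) (e : R) N :
  (forall i, (i < N)%N -> t i < t i.+1) ->
  (forall i, (i <= N)%N -> 0 < e * (-1) ^+ i * f.[t i]) ->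
  exists s : seq R, [/\ size s = N, sorted <%R s, all (root f) s &
    forall i, (i < N)%N -> t i < nth 0 s i < t i.+1].
Proof.
move=> t_inc alt.
have ex i : exists z, (i < N)%N -> root f z /\ t i < z < t i.+1.
  case: (ltnP i N) => [ltiN|_]; last by exists 0.
  have le_t := ltW (t_inc _ ltiN).
  have h0 := alt i (ltnW ltiN); have h1 := alt i.+1 ltiN.
  have sgn : f.[t i] * f.[t i.+1] < 0.
    have := mulr_gt0 h0 h1; rewrite exprS.
    have -> : e * (-1) ^+ i * f.[t i] * (e * (-1 * (-1) ^+ i) * f.[t i.+1]) =
        - ((e * (-1) ^+ i) ^+ 2 * (f.[t i] * f.[t i.+1])) by ring.
    rewrite oppr_gt0 pmulr_rlt0 // exprn_even_gt0 //=.
    by apply: contraTneq h0 => ->; rewrite mul0r ltxx.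
  have [z + rz] := poly_ivtoo le_t sgn; rewrite in_itv /= => zi.
  by exists z.
have [g gP] := choice ex.
exists (mkseq g N); rewrite size_mkseq; split=> //.
- case: N t_inc gP {alt ex} => // N t_inc gP.
  apply/(sortedP 0) => i; rewrite size_mkseq => ltiN.
  rewrite !nth_mkseq //; last exact: ltnW.
  have [_ /andP[_ h1]] := gP i (ltnW ltiN).
  by have [_ /andP[h2 _]] := gP i.+1 ltiN; apply: lt_trans h2.
- apply/allP => z /mapP[i]; rewrite mem_iota add0n => /= ltiN ->.
  by case: (gP i ltiN).
- by move=> i ltiN; rewrite nth_mkseq //; case: (gP i ltiN).
Qed.

(** Exhibiting as many roots as the
    degree identifies the whole list and factors the polynomial. *)
Lemma rootsR_eq (R : rcfType) (p : {poly R}) (s : seq R) :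
  p != 0 -> sorted <%R s -> all (root p) s -> (size p <= (size s).+1)%N ->
  rootsR p = s /\ p = lead_coef p *: \prod_(z <- s) ('X - z%:P).
Proof.
move=> p0 s_sorted s_root le_ps; have s_uniq := lt_sorted_uniq s_sorted.
have sp : size p = (size s).+1.
  by apply/eqP; rewrite eqn_leq le_ps max_poly_roots.
split; last by apply: all_roots_prod_XsubC; rewrite ?uniq_rootsE.
apply: lt_sorted_eq => //; first exact: sorted_roots.
move=> x; apply/esym.
have sub : {subset s <= rootsR p}.
  move=> z zs; rewrite -(roots_on_rootsR p0) ?in_itv //=.
  exact: (allP s_root).
apply: (uniq_min_size s_uniq sub _).2.
rewrite -ltnS -sp; apply: max_poly_roots => //; last first.
  exact/lt_sorted_uniq/sorted_roots.
by apply/allP => z; rewrite -(roots_on_rootsR p0) => /andP[].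
Qed.

Lemma lead_coef_sgn_pinfty (R : realFieldType) (f : {poly R}) (e x : R) :
  0 < e * lead_coef f -> exists2 y, x < y & 0 < e * f.[y].
Proof.
rewrite -lead_coefZ => lc; have [n nP] := poly_pinfty_gt_lc lc.
exists (Num.max n (x + 1)); first by rewrite lt_max ltrDl ltr01 orbT.
by rewrite -hornerZ; apply: lt_le_trans lc (nP _ _); rewrite le_max lexx.
Qed.

(** With [u = - p'/p], the sum of [1/(z - x)] over the roots [z], [d] is
    [p.[x] ^+ 2] times [u' = sum of 1/(z - x)^2]: the two bounds say that
    [0 <= u'] and that [rho * u' <= u], since [rho <= z - x] for each root.
    Clearing denominators allows an induction on the list of roots. *)
Lemma laguerre_inequality (R : realFieldType) (s : seq R) (c rho x : R)
    (p := c *: \prod_(z <- s) ('X - z%:P)) :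
  0 <= rho -> all (>= (x + rho)) s ->
  let d := p^`().[x] ^+ 2 - p.[x] * p^`()^`().[x] in
  0 <= d /\ rho * d <= - (p.[x] * p^`().[x]).
Proof.
move=> rho0 s_ge; rewrite {}/p.
suff : let p := \prod_(z <- s) ('X - z%:P) in
  let d := p^`().[x] ^+ 2 - p.[x] * p^`()^`().[x] in
  0 <= d /\ rho * d <= - (p.[x] * p^`().[x]).
  set p := \prod_(z <- s) _; rewrite /= !derivZ !hornerZ => -[d0 le_d].
  have c2 := sqr_ge0 c.
  set d := _ - _ in d0 le_d; set d' := _ - _.
  have -> : d' = c ^+ 2 * d by rewrite /d' /d; ring.
  rewrite mulr_ge0 //; split=> //.
  have -> : - (c * p.[x] * (c * p^`().[x])) = c ^+ 2 * - (p.[x] * p^`().[x]).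
    by ring.
  by rewrite mulrCA ler_wpM2l.
elim: s s_ge => [_|z s IHs /andP[/= xz /IHs]].
  rewrite big_nil /= derivC deriv0 !horner0 !hornerE; split; lra.
rewrite big_cons /=; set q := \prod_(y <- s) _ => -[d0 le_d].
rewrite derivM derivXsubC mul1r derivD derivM derivXsubC mul1r.
rewrite 3!hornerD !hornerM hornerXsubC.
move: d0 le_d; set q0 := q.[x]; set q1 := q^`().[x]; set q2 := q^`()^`().[x].
set d := q1 ^+ 2 - q0 * q2 => d0 le_d.
have -> : (q0 + (x - z) * q1) ^+ 2 - (x - z) * q0 * (q1 + (q1 + (x - z) * q2)) =
   q0 ^+ 2 + (x - z) ^+ 2 * d by rewrite /d; ring.
have -> : - ((x - z) * q0 * (q0 + (x - z) * q1)) =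
   (z - x) * q0 ^+ 2 + (x - z) ^+ 2 * - (q0 * q1) by ring.
split; first exact: addr_ge0 (sqr_ge0 _) (mulr_ge0 (sqr_ge0 _) d0).
rewrite mulrDr lerD //; last by rewrite mulrCA ler_wpM2l ?sqr_ge0.
by rewrite ler_wpM2r ?sqr_ge0 // lerBrDl.
Qed.

(** * Roots of Laguerre polynomials *)

(** The values of [f] at the roots of [L] are those of [L'] up to factors of
    constant sign, hence alternate; a sign at 0 and one at infinity that
    continue the pattern give one more root on either side. *)
Lemma interlacing_roots (R : rcfType) (s : seq R) (c e : R) (w : R -> R)
    (f : {poly R}) (L := (c * (-1) ^+ size s) *: \prod_(z <- s) ('X - z%:P)) :
  sorted <%R s -> all (> 0) s -> 0 < c ->
  0 < e * f.[0] ->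
  {in s, forall z, f.[z] = w z * L^`().[z] /\ 0 < e * w z} ->
  0 < e * (-1) ^+ (size s).+1 * lead_coef f ->
  exists s' : seq R, [/\ size s' = (size s).+1, sorted <%R s',
    all (> 0) s', all (root f) s' &
    (0 < size s)%N -> nth 0 s' 0 < nth 0 s 0].
Proof.
move=> s_sorted s_gt0 c0 f0 fs lc.
have [B ltB fB] := lead_coef_sgn_pinfty (last 0 s) lc.
pose t := nth 0 (0 :: rcons s B).
have t_sorted : sorted <%R (0 :: rcons s B).
  rewrite /= rcons_path ltB andbT path_sortedE ?s_sorted ?andbT //.
  exact: lt_trans.
have t_inc i : (i < (size s).+1)%N -> t i < t i.+1.
  move=> ltis; have /(sortedP 0) := t_sorted; apply.
  by rewrite /= size_rcons !ltnS.
have alt i : (i <= (size s).+1)%N -> 0 < e * (-1) ^+ i * f.[t i].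
  case: i => [|i]; first by rewrite expr0 mulr1.
  rewrite ltnS leq_eqVlt /t /= => /predU1P[->|ltis].
    by rewrite nth_rcons ltnn eqxx.
  rewrite nth_rcons ltis; have [-> ew] := fs _ (mem_nth 0 ltis).
  rewrite derivZ hornerZ mulrACA.
  apply: mulr_gt0 => //; have := deriv_prod_XsubC_sgn s_sorted ltis.
  set d := (deriv _).[_] => d_gt0.
  have -> : (-1) ^+ i.+1 * (c * (-1) ^+ size s * d) =
      c * ((-1) ^+ (size s - i.+1) * d) :> R.
    set k := (size s - i.+1)%N; have -> : size s = (i.+1 + k)%N by rewrite subnKC.
    by rewrite exprD -!mulrA mulrCA signrMK.
  exact: mulr_gt0.
have [s' [size_s' s'_sorted s'_root s'_loc]] := alternating_roots t_inc alt.
exists s'; split=> //.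
- apply/(all_nthP 0) => i; rewrite size_s' => ltis /=.
  have /andP[+ _] := s'_loc i ltis; apply: le_lt_trans.
  case: i ltis => // i ltis; rewrite /t /= nth_rcons -ltnS ltis ltW //.
  by apply: (allP s_gt0); rewrite mem_nth.
- move=> s_gt; have /andP[_] := s'_loc 0%N isT.
  by rewrite /t /= nth_rcons s_gt.
Qed.

Lemma size_laguerre (R : realType) (a : R) (n : nat) :
  size (laguerre a n) = n.+1.
Proof.
apply/eqP; rewrite eqn_leq; apply/andP; split.
  by apply/leq_sizeP => j ltnj; rewrite coef_laguerre leqNgt ltnj.
rewrite ltnNge; apply/negP => /leq_sizeP/(_ n (leqnn n))/eqP; apply/negP.
rewrite coef_laguerre leqnn subnn gbinom0 mulr1.
by rewrite mulf_neq0 ?signr_eq0 // invr_eq0 pnatr_eq0 -lt0n fact_gt0.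
Qed.

Lemma lead_coef_laguerre (R : realType) (a : R) (n : nat) :
  lead_coef (laguerre a n) = n`!%:R^-1 * (-1) ^+ n.
Proof.
rewrite lead_coefE size_laguerre coef_laguerre leqnn subnn gbinom0 mulr1.
exact: mulrC.
Qed.

Lemma laguerre0 (R : realType) (a : R) : laguerre a 0%N = 1.
Proof.
apply/polyP => -[|j]; rewrite coef_laguerre coef1 //=.
by rewrite gbinom0 fact0 expr0 invr1 !mulr1.
Qed.

Lemma laguerre_at0_gt0 (R : realType) (a : R) (n : nat) :
  -1 < a -> 0 < (laguerre a n).[0].
Proof.
elim: n a => [|n IHn] a a_gt.
  by rewrite laguerre0 hornerC ltr01.
have := congr1 (horner^~ 0) (laguerre_raise a n).
rewrite hornerZ hornerD !hornerM hornerX mul0r add0r hornerD hornerN hornerX.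
rewrite hornerC subr0 => E; rewrite -(pmulr_rgt0 _ (ltr0Sn R n)) E.
by apply: mulr_gt0; [lra | apply: IHn; lra].
Qed.

(** Induction on the degree for all parameters at once: at a root [z] of
    [L_n^(a+1)], [laguerre_raise] gives [n.+1 * L_(n+1)^a (z)] as [z] times the
    derivative of [L_n^(a+1)], so that the roots interlace. *)
Lemma laguerre_roots (R : realType) (a : R) (n : nat) : -1 < a ->
  exists s : seq R, [/\ size s = n, sorted <%R s, all (> 0) s &
    laguerre a n = (n`!%:R^-1 * (-1) ^+ n) *: \prod_(z <- s) ('X - z%:P)].
Proof.
elim: n a => [|n IHn] a a_gt.
  exists [::]; split=> //; rewrite big_nil alg_polyC -(lead_coef_laguerre a).
  by rewrite laguerre0 lead_coef1.
have a1_gt : -1 < a + 1 by lra.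
have [s [size_s s_sorted s_gt0 LE]] := IHn _ a1_gt.
have n_gt0 : 0 < n.+1%:R :> R by rewrite ltr0Sn.
have c_gt0 k : 0 < k`!%:R^-1 :> R by rewrite invr_gt0 ltr0n fact_gt0.
have lc : 0 < n.+1%:R * (-1) ^+ (size s).+1 * lead_coef (laguerre a n.+1).
  rewrite lead_coef_laguerre size_s mulrACA -exprD addnn -mul2n exprM sqrrN.
  by rewrite !expr1n mulr1 mulr_gt0.
have f0 : 0 < n.+1%:R * (laguerre a n.+1).[0].
  by rewrite mulr_gt0 ?laguerre_at0_gt0.
have fs : {in s, forall z, (laguerre a n.+1).[z] = n.+1%:R^-1 * z *
    ((n`!%:R^-1 * (-1) ^+ size s) *: \prod_(z <- s) ('X - z%:P))^`().[z] /\
    0 < n.+1%:R * (n.+1%:R^-1 * z)}.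
  move=> z zs; rewrite mulrA divff ?gt_eqF // mul1r; split; last first.
    exact: (allP s_gt0).
  have Lz : (laguerre (a + 1) n).[z] = 0 by rewrite LE horner_prod_XsubC_root.
  apply: (mulfI (lt0r_neq0 n_gt0)); rewrite -hornerZ laguerre_raise size_s -LE.
  by rewrite hornerD !hornerM Lz mulr0 addr0 hornerX !mulrA divff ?gt_eqF ?mul1r.
have [s' [size_s' s'_sorted s'_gt0 s'_root _]] :=
  interlacing_roots s_sorted s_gt0 (c_gt0 n) f0 fs lc.
rewrite size_s in size_s'; exists s'; split => //.
have Lnz : laguerre a n.+1 != 0 by rewrite -size_poly_gt0 size_laguerre.
rewrite -(lead_coef_laguerre a); apply: (rootsR_eq Lnz s'_sorted s'_root _).2.
by rewrite size_laguerre size_s'.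
Qed.

(** * Logarithmic derivative and first root for large degree *)

Lemma laguerre_ode (R : realType) (a : R) (n : nat) (L := laguerre a n) :
  'X * L^`()^`() + ((a + 1)%:P - 'X) * L^`() + n%:R *: L = 0.
Proof.
rewrite /L; case: n {L} => [|n].
  by rewrite laguerre0 derivC deriv0 scale0r !mulr0 !addr0.
rewrite laguerre_deriv derivN laguerre_raise; ring.
Qed.

Lemma laguerre_gt0 (R : realType) (a x : R) (n : nat) :
  -1 < a -> x <= 0 -> 0 < (laguerre a n).[x].
Proof.
move=> a_gt x_le0; have [s [<- _ s_gt0 ->]] := laguerre_roots n a_gt.
have gt_s : all (> x) s by apply: sub_all s_gt0 => z; apply: le_lt_trans.
rewrite hornerZ -mulrA mulr_gt0 ?invr_gt0 ?ltr0n ?fact_gt0 //.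
by have := prod_XsubC_sgn (s1 := [::]) (x := x) isT gt_s; rewrite cat0s.
Qed.

Lemma laguerre_deriv_le0 (R : realType) (a x : R) (n : nat) :
  -1 < a -> x <= 0 -> (laguerre a n)^`().[x] <= 0.
Proof.
move=> a_gt x_le0; case: n => [|n]; first by rewrite laguerre0 derivC horner0.
rewrite laguerre_deriv hornerN oppr_le0 ltW // laguerre_gt0 //; lra.
Qed.

(** If [u = - L'/L < C] at [x], the differential equation and Laguerre's
    inequality bound [n] by [- x * C ^+ 2 + (a + 1 - x) * C]. *)
Lemma laguerre_logderiv_unbounded (R : realType) (a x C : R) :
  -1 < a -> x < 0 -> 0 <= C ->
  exists N : nat, forall n, (N <= n)%N ->
    C * (laguerre a n).[x] <= - (laguerre a n)^`().[x].
Proof.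
move=> a_gt x_lt0 C0.
pose B := - x * C ^+ 2 + (a + 1 - x) * C.
exists (Num.truncn B).+1 => n leNn.
have ltBn : B < n%:R.
  by apply: lt_le_trans (truncnS_gt B) _; rewrite ler_nat.
rewrite leNgt; apply/negP => lt_DL.
have L0 := laguerre_gt0 n a_gt (ltW x_lt0).
have D0 := laguerre_deriv_le0 n a_gt (ltW x_lt0).
have [s [_ _ s_gt0 LE]] := laguerre_roots n a_gt.
have s_ge : all (>= (x + 0)) s.
  apply: sub_all s_gt0 => z /= z0; rewrite addr0 ltW //; exact: lt_trans z0.
have [+ _] := laguerre_inequality (n`!%:R^-1 * (-1) ^+ n) (lexx 0) s_ge.
rewrite -LE.
have := congr1 (horner^~ x) (laguerre_ode a n).
rewrite /= !hornerD !hornerM hornerZ hornerD hornerN !hornerX hornerC horner0.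
move: lt_DL L0 D0; set l := (laguerre a n).[x]; set l1 := _^`().[x].
set l2 := _.[x] => lt_DL L0 D0 ode ineq.
suff : n%:R * l ^+ 2 <= B * l ^+ 2.
  by rewrite ler_pM2r ?exprn_gt0 // leNgt ltBn.
have -> : n%:R * l ^+ 2 = - x * (l * l2) + (a + 1 - x) * (- l1 * l).
  have -> : n%:R * l ^+ 2 = n%:R * l * l by ring.
  have -> : n%:R * l = - (x * l2 + (a + 1 - x) * l1) by lra.
  by ring.
have -> : B * l ^+ 2 = - x * (C * l) ^+ 2 + (a + 1 - x) * (C * l * l).
  by rewrite /B; ring.
apply: lerD.
  rewrite ler_pM2l ?oppr_gt0 //; apply: (@le_trans _ _ ((- l1) ^+ 2)).
    by rewrite sqrrN -subr_ge0.
  apply: lerXn2r; rewrite ?nnegrE ?oppr_ge0 //; last exact: ltW.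
  exact: mulr_ge0 C0 (ltW L0).
rewrite ler_pM2l; last lra.
by rewrite ler_pM2r // ltW.
Qed.

(** The bound [s_0 * u'(0) <= u(0)] for [u = - L'/L]; the differential
    equation at 0, for [L] and for [L'], expresses [L'(0)] and [L''(0)] as
    multiples of [L(0)]. *)
Lemma laguerre_first_root_le (R : realType) (a c : R) (n : nat) (s : seq R) :
  -1 < a -> size s = n.+1 -> sorted <%R s -> all (> 0) s ->
  laguerre a n.+1 = c *: \prod_(z <- s) ('X - z%:P) ->
  nth 0 s 0 <= (a + 1) * (a + 2) / n.+1%:R.
Proof.
move=> a_gt size_s s_sorted s_gt0 LE.
have s0_gt0 : 0 < nth 0 s 0 by apply: (allP s_gt0); rewrite mem_nth ?size_s.
have s_ge : all (>= (0 + nth 0 s 0)) s.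
  apply/(all_nthP 0) => i ltis; rewrite /= add0r.
  by rewrite lt_sorted_leq_nth ?inE // size_s.
have [_] := laguerre_inequality c (ltW s0_gt0) s_ge.
rewrite -LE.
have := congr1 (horner^~ 0) (laguerre_ode a n.+1).
have := congr1 (horner^~ 0) (laguerre_ode (a + 1) n).
have := @laguerre_gt0 R (a + 1) 0 n; rewrite lexx.
rewrite /= laguerre_deriv derivN !hornerD !hornerM !hornerZ !hornerD !hornerN.
rewrite !hornerX !hornerC !mul0r.
set l := (laguerre a n.+1).[0]; set d := (laguerre _ n).[0].
set d1 := _.[0] => d_gt0 ode1 ode ineq.
have {}d_gt0 : 0 < d by apply: d_gt0 => //; lra.
set rho := nth 0 s 0 in ineq s0_gt0 *.
have n1 : 0 < n.+1%:R :> R by rewrite ltr0Sn.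
rewrite ler_pdivlMr //.
have A0 : 0 < a + 1 by lra.
have nE : n.+1%:R = n%:R + 1 :> R by rewrite natr1.
have E1 : n.+1%:R * l = (a + 1) * d by lra.
have E2 : (a + 2) * d1 = - (n%:R * d) by lra.
suff h : rho * (n.+1%:R + (a + 1)) <= (a + 1) * (a + 2).
  by apply: le_trans h; rewrite mulrDr lerDl mulr_ge0 // ltW.
rewrite -(ler_pM2r (exprn_gt0 2 d_gt0)).
have -> : (a + 1) * (a + 2) * d ^+ 2 = n.+1%:R * (a + 2) * - (l * - d).
  transitivity (n.+1%:R * l * ((a + 2) * d)); last by ring.
  by rewrite E1; ring.
have -> : rho * (n.+1%:R + (a + 1)) * d ^+ 2 =
    n.+1%:R * (a + 2) * (rho * ((- d) ^+ 2 - l * - d1)).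
  transitivity (rho * (n.+1%:R * (a + 2) * d ^+ 2
                       + (n.+1%:R * l) * ((a + 2) * d1))); last by ring.
  by rewrite E1 E2 nE; ring.
rewrite ler_wpM2l // mulr_ge0 // ?ler0n //; lra.
Qed.

(** * Roots of the exceptional polynomials *)

(** The factor [(m + 1) L_(m+1)^(-alpha-2)(-x)] of the definition is rewritten
    in terms of [Q] and [Q'] by [laguerre_raise], and [L_(n-1)^(alpha+2)] is
    [- L'], also for [n = 0]. *)
Lemma xlaguerre3E (R : realType) (alpha : R) (m n : nat)
    (L := laguerre (alpha + 1) n) (Q := laguerre (- alpha - 1) m \Po - 'X) :
  xlaguerre3 alpha m (m + n.+1) =
  'X * (L * Q^`() - L^`() * Q) + ((- alpha - 1)%:P + 'X) * (L * Q).
Proof.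
rewrite /xlaguerre3 addnS /=.
have -> : (m + n).+1%:Z - m%:Z - 1 = n by lia.
have -> : laguerre (alpha + 2) ((m + n).+1%:Z - m%:Z - 2) = - L^`().
  rewrite /L; case: n {L} => [|n].
    have -> : (m + 0).+1%:Z - m%:Z - 2 = -1 :> int by lia.
    by rewrite laguerre0 derivC oppr0.
  have -> : (m + n.+1).+1%:Z - m%:Z - 2 = n :> int by lia.
  by rewrite laguerre_deriv opprK -addrA.
rewrite scalerAr -comp_polyZ.
have := laguerre_raise (- alpha - 2) m.
have -> : - alpha - 2 + 1 = - alpha - 1 by ring.
move=> ->; rewrite -/L.
rewrite rmorphD /= !rmorphM /= rmorphB /= comp_polyX comp_polyC.
have -> : (laguerre (- alpha - 1) m)^`() \Po - 'X = - Q^`().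
  by rewrite deriv_comp derivN derivX mulrN1 opprK.
rewrite -/Q; ring.
Qed.

Lemma size_lead_reflected_laguerre (R : realType) (a : R) (m : nat)
    (Q := laguerre a m \Po - 'X) :
  size Q = m.+1 /\ lead_coef Q = m`!%:R^-1.
Proof.
have size_N : size (- 'X : {poly R}) = 2 by rewrite size_polyN size_polyX.
rewrite /Q size_comp_poly2 // lead_coef_comp ?size_N // lead_coefN lead_coefX.
rewrite lead_coef_laguerre size_laguerre -mulrA -exprD addnn -mul2n exprM.
by rewrite sqrrN !expr1n mulr1.
Qed.

Lemma reflected_laguerre_roots (R : realType) (a : R) (m : nat)
    (Q := laguerre a m \Po - 'X) : -1 < a ->
  exists q : seq R, [/\ size q = m, sorted <%R q, all (< 0) q,
    Q = m`!%:R^-1 *: \prod_(z <- q) ('X - z%:P) & rootsR Q = q].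
Proof.
move=> a_gt; have [s [size_s s_sorted s_gt0 LE]] := laguerre_roots m a_gt.
have [size_Q lc] := size_lead_reflected_laguerre a m.
pose q := rev (map -%R s).
have q_sorted : sorted <%R q.
  rewrite rev_sorted sorted_map; apply: sub_sorted s_sorted => x y /= xy.
  by rewrite ltrN2.
have size_q : size q = m by rewrite size_rev size_map.
have Q0 : Q != 0 by rewrite -size_poly_gt0 size_Q.
have q_root : all (root Q) q.
  rewrite all_rev all_map; apply/allP => z zs /=.
  rewrite /root horner_comp hornerN hornerX opprK LE.
  by rewrite horner_prod_XsubC_root.
have le_Qq : (size Q <= (size q).+1)%N by rewrite size_Q size_q.
exists q; have [-> QE] := rootsR_eq Q0 q_sorted q_root le_Qq.
split=> //; last by rewrite {1}QE lc.
by rewrite all_rev all_map; apply: sub_all s_gt0 => z /=; rewrite oppr_lt0.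
Qed.

Lemma size_lead_xlaguerre3 (R : realType) (alpha : R) (m n : nat)
    (P := xlaguerre3 alpha m (m + n.+1)) :
  size P = (m + n.+1).+1 /\ lead_coef P = m`!%:R^-1 * n`!%:R^-1 * (-1) ^+ n.
Proof.
rewrite /P xlaguerre3E; set L := laguerre _ n; set Q := _ \Po _.
have [size_Q lcQ] := size_lead_reflected_laguerre (- alpha - 1) m.
have size_L : size L = n.+1 by rewrite size_laguerre.
have L0 : L != 0 by rewrite -size_poly_gt0 size_L.
have Q0 : Q != 0 by rewrite -size_poly_gt0 size_Q.
have size_LQ : size (L * Q) = (m + n.+1)%N.
  by rewrite size_mul // size_L size_Q; lia.
have size_XLQ : size ('X * (L * Q)) = (m + n.+1).+1.
  by rewrite mulrC size_mulX ?mulf_neq0 // size_LQ.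
set b := - alpha - 1.
have -> : 'X * (L * Q^`() - L^`() * Q) + (b%:P + 'X) * (L * Q) =
    'X * (L * Q^`() - L^`() * Q) + b *: (L * Q) + 'X * (L * Q).
  by rewrite -mul_polyC; ring.
set r := _ + b *: _.
have size_r : (size r <= m + n.+1)%N.
  rewrite /r; apply: leq_trans (size_polyD _ _) _.
  rewrite geq_max (leq_trans (size_scale_leq _ _)) ?size_LQ // andbT.
  apply: leq_trans (size_mul_leq _ _) _; rewrite size_polyX /=.
  rewrite addnS ltnS; apply: leq_trans (size_polyD _ _) _.
  rewrite geq_max size_polyN; apply/andP; split.
    apply: leq_trans (size_mul_leq _ _) _; rewrite size_L addSn /=.
    by have := lt_size_deriv Q0; rewrite size_Q ltnS addnC leq_add2r.
  apply: leq_trans (size_mul_leq _ _) _; rewrite size_Q addnS /= addnC.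
  by have := lt_size_deriv L0; rewrite size_L ltnS leq_add2l.
rewrite addrC size_polyDl ?size_XLQ // lead_coefDl ?size_XLQ //; split=> //.
by rewrite !lead_coefM lead_coefX mul1r lead_coef_laguerre lcQ; ring.
Qed.

Lemma signr_even (R : pzRingType) (i j : nat) :
  odd i = odd j -> (-1) ^+ i = (-1) ^+ j :> R.
Proof. by move=> ij; rewrite -signr_odd ij signr_odd. Qed.

(** The interlacing of the negative roots with those of [Q] is recorded for
    matching indices in the limit; the bound on the first positive root comes
    from the first root of [L_n^(alpha+1)]. *)
Lemma xlaguerre3_roots (R : realType) (alpha : R) (m n : nat)
    (P := xlaguerre3 alpha m (m + n.+1))
    (Q := laguerre (- alpha - 1) m \Po - 'X) :
  -1 < alpha -> alpha < 0 ->
  [/\ P != 0,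
      size (neg_roots P) = m,
      size (pos_roots P) = n.+1,
      (forall i, (i < m)%N -> nth 0 (neg_roots P) i < nth 0 (rootsR Q) i /\
         ((0 < i)%N -> nth 0 (rootsR Q) i.-1 < nth 0 (neg_roots P) i)) &
      (0 < n)%N -> 0 < nth 0 (pos_roots P) 0 <=
        (alpha + 2) * (alpha + 3) / n%:R].
Proof.
move=> alpha_gt alpha_lt.
have b_gt : -1 < - alpha - 1 by lra.
have a_gt : -1 < alpha + 1 by lra.
have [q [size_q q_sorted q_lt0 QE ->]] := reflected_laguerre_roots m b_gt.
have [s [size_s s_sorted s_gt0 LE]] := laguerre_roots n a_gt.
have [size_P lcP] := size_lead_xlaguerre3 alpha m n.
have PE := xlaguerre3E alpha m n; rewrite -/Q -/P in QE size_P lcP PE.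
set L := laguerre (alpha + 1) n in PE LE.
have c_gt0 k : 0 < k`!%:R^-1 :> R by rewrite invr_gt0 ltr0n fact_gt0.
have Pnz : P != 0 by rewrite -size_poly_gt0 size_P.
have Qx_gt0 x : 0 <= x -> 0 < Q.[x].
  by move=> x0; rewrite horner_comp hornerN hornerX laguerre_gt0 // oppr_le0.
have Lx_gt0 x : x <= 0 -> 0 < L.[x] by move=> x0; rewrite laguerre_gt0.
have Px x : P.[x] = x * (L.[x] * Q^`().[x] - L^`().[x] * Q.[x])
    + (- alpha - 1 + x) * (L.[x] * Q.[x]).
  by rewrite PE !(hornerE, hornerM, hornerD, hornerN, hornerX, hornerC).
(* At a root z of L, P is - z Q(z) L'(z), and Q > 0 on the positive axis. *)
have [ps [size_ps ps_sorted ps_gt0 ps_root ps_lt]] :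
  exists ps : seq R, [/\ size ps = n.+1, sorted <%R ps, all (> 0) ps,
    all (root P) ps & (0 < size s)%N -> nth 0 ps 0 < nth 0 s 0].
  rewrite -{1}size_s.
  apply: (@interlacing_roots _ _ n`!%:R^-1 (-1) (fun z => - (z * Q.[z]))) => //.
  - rewrite Px mul0r add0r addr0 mulrA mulr_gt0 //; last first.
      by rewrite mulr_gt0 ?Lx_gt0 ?Qx_gt0.
    by lra.
  - move=> z zs; have z0 := allP s_gt0 _ zs.
    rewrite Px {1 3}LE horner_prod_XsubC_root // size_s -LE; split; first by ring.
    by rewrite mulN1r opprK mulr_gt0 // Qx_gt0 // ltW.
  - rewrite lcP size_s exprS !mulN1r opprK.
    rewrite mulrCA -exprD addnn -mul2n exprM sqrrN !expr1n mulr1.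
    exact: mulr_gt0.
(* A point - B to the left of all roots of Q where P has the sign it has at
   minus infinity, found at + infinity for the reflected polynomial. *)
have [B ltB PB] : exists2 B, - nth 0 q 0 < B & 0 < (-1) ^+ m.+1 * P.[- B].
  have size_N : size (- 'X : {poly R}) = 2 by rewrite size_polyN size_polyX.
  have lc : 0 < (-1) ^+ m.+1 * lead_coef (P \Po - 'X).
    rewrite lead_coef_comp ?size_N // lead_coefN lead_coefX size_P lcP /=.
    rewrite -!mulrA -exprD mulrCA mulr_gt0 // mulrCA mulr_gt0 // -exprD.
    rewrite (@signr_even _ _ 0) // !(oddD, oddS).
    by case: (odd m); case: (odd n).
  have [B ltB PB] := lead_coef_sgn_pinfty (- nth 0 q 0) lc.
  by exists B; rewrite // horner_comp hornerN hornerX in PB.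
pose t := nth 0 (- B :: q).
have t_inc i : (i < m)%N -> t i < t i.+1.
  case: i => [|i] ltim; first by rewrite /t /= ltrNl.
  by rewrite /t /= lt_sorted_ltn_nth ?inE ?size_q // ltnW.
have alt i : (i <= m)%N -> 0 < (-1) ^+ m.+1 * (-1) ^+ i * P.[t i].
  case: i => [|i] ltim; first by rewrite /t /= mulr1.
  have qi : nth 0 q i \in q by rewrite mem_nth ?size_q.
  have qi_lt0 := allP q_lt0 _ qi; rewrite /t /= Px.
  have Qqi : Q.[nth 0 q i] = 0 by rewrite QE horner_prod_XsubC_root.
  rewrite Qqi !mulr0 subr0 addr0 -exprD.
  have := @deriv_prod_XsubC_sgn _ q i q_sorted; rewrite size_q => /(_ ltim).
  rewrite QE derivZ hornerZ; set d := _^`().[_] => d_gt0.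
  have -> : (-1) ^+ (m.+1 + i.+1) = - (-1) ^+ (m - i.+1) :> R.
rewrite -[RHS]mulN1r -exprS; apply: signr_even.
    rewrite !(oddD, oddS) oddB // !(oddD, oddS). by case: (odd m); case: (odd i).
  rewrite mulNr mulrCA -mulNr mulr_gt0 ?oppr_gt0 //.
  rewrite mulrCA mulr_gt0 ?Lx_gt0 1?ltW //.
  by rewrite mulrCA mulr_gt0.
have [ng [size_ng ng_sorted ng_root ng_loc]] := alternating_roots t_inc alt.
have ng_lt i : (i < m)%N -> nth 0 ng i < nth 0 q i.
  by move=> /ng_loc/andP[].
have ng_lt0 : all (< 0) ng.
  apply/(all_nthP 0) => i; rewrite size_ng => ltim /=.
  apply: lt_trans (ng_lt i ltim) _; apply: (allP q_lt0).
  by rewrite mem_nth ?size_q.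
(* These are m + n + 1 roots, which is the degree of P. *)
have [rootsP _] : rootsR P = ng ++ ps /\
    P = lead_coef P *: \prod_(z <- ng ++ ps) ('X - z%:P).
  apply: rootsR_eq; rewrite ?all_cat ?ng_root //; last first.
    by rewrite size_cat size_ng size_ps size_P.
  rewrite lt_sorted_pairwise pairwise_cat -!lt_sorted_pairwise ng_sorted.
  rewrite ps_sorted !andbT; apply/allrelP => x y xng yps.
  exact: lt_trans (allP ng_lt0 _ xng) (allP ps_gt0 _ yps).
have -> : neg_roots P = ng.
  rewrite /neg_roots rootsP filter_cat (all_filterP ng_lt0).
  rewrite (eq_in_filter (a2 := pred0)) ?filter_pred0 ?cats0 // => z zps /=.
  exact: lt_gtF (allP ps_gt0 z zps).
have -> : pos_roots P = ps.
  rewrite /pos_roots rootsP filter_cat (all_filterP ps_gt0).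
  rewrite (eq_in_filter (a2 := pred0)) ?filter_pred0 // => z zng /=.
  exact: lt_gtF (allP ng_lt0 z zng).
split=> //.
  move=> i ltim; split; first exact: ng_lt.
  by case: i ltim => // i ltim _; have /andP[] := ng_loc _ ltim.
move=> n_gt0; have s_ne : (0 < size s)%N by rewrite size_s.
apply/andP; split; first by apply: (allP ps_gt0); rewrite mem_nth ?size_ps.
apply: le_trans (ltW (ps_lt s_ne)) _.
move: LE size_s; rewrite /L -(prednK n_gt0) => LE size_s.
have := laguerre_first_root_le a_gt size_s s_sorted s_gt0 LE.
have -> : alpha + 1 + 1 = alpha + 2 by ring.
by have -> : alpha + 1 + 2 = alpha + 3 by ring.
Qed.

(** At a point [x] slightly left of the root of [Q] with index [i], the growth
    of [- L'/L] eventually gives [P] the sign opposite to its sign at that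
    root. *)
Lemma xlaguerre3_neg_root_near (R : realType) (alpha eps : R) (m i : nat)
    (Q := laguerre (- alpha - 1) m \Po - 'X) :
  -1 < alpha -> alpha < 0 -> (i < m)%N -> 0 < eps ->
  exists N : nat, forall n, (N <= n)%N ->
    nth 0 (rootsR Q) i - eps
      < nth 0 (neg_roots (xlaguerre3 alpha m (m + n.+1))) i
      < nth 0 (rootsR Q) i.
Proof.
move=> alpha_gt alpha_lt ltim eps_gt0.
have b_gt : -1 < - alpha - 1 by lra.
have a_gt : -1 < alpha + 1 by lra.
have [q [size_q q_sorted q_lt0 QE qE]] := reflected_laguerre_roots m b_gt.
rewrite -/Q in QE qE.
have ltiq : (i < size q)%N by rewrite size_q.
have [lt_take lt_drop] := lt_sorted_split q_sorted ltiq.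
set xi := nth 0 q i in lt_take lt_drop.
have xi_lt0 : xi < 0 by apply: (allP q_lt0); rewrite mem_nth.
(* A point x left of xi, within eps of it and right of the previous root. *)
have [x [x_gt x_lt x_take]] : exists x,
    [/\ xi - eps < x, x < xi & (0 < i)%N -> nth 0 q i.-1 < x].
  case: (posnP i) => [i0|i_gt0].
    by exists (xi - eps / 2); split; rewrite ?i0 //; lra.
  have lt_prev : nth 0 q i.-1 < xi.
    by rewrite /xi lt_sorted_ltn_nth ?inE ?prednK // ltnW.
  have [le|lt] := leP (nth 0 q i.-1) (xi - eps).
    by exists (xi - eps / 2); split=> [||_]; lra.
  by exists ((nth 0 q i.-1 + xi) / 2); split=> [||_]; lra.
have x_lt0 : x < 0 := lt_trans x_lt xi_lt0.
pose sg : R := (-1) ^+ (m - i).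
have sgQ : 0 < sg * Q.[x].
  have all_take : all (< x) (take i q).
    apply/(all_nthP 0) => j; rewrite size_takel ?(ltnW ltiq) // => ltji /=.
    have i_gt0 := leq_ltn_trans (leq0n j) ltji.
    rewrite nth_take //; apply: le_lt_trans (x_take i_gt0).
    rewrite lt_sorted_leq_nth ?inE ?size_q //.
    - by rewrite -ltnS prednK.
    - exact: ltn_trans ltim.
    - by apply: leq_ltn_trans ltim; apply: leq_pred.
  have all_drop : all (> x) (drop i q).
    rewrite (drop_nth 0 ltiq) /= x_lt; apply: sub_all lt_drop => z /=.
    exact: lt_trans.
  have := prod_XsubC_sgn all_take all_drop.
  rewrite cat_take_drop size_drop size_q -/sg => sgp.
  by rewrite QE hornerZ mulrCA mulr_gt0 // invr_gt0 ltr0n fact_gt0.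
have sgQ' : sg * Q^`().[xi] < 0.
  have := deriv_prod_XsubC_sgn q_sorted ltiq; rewrite size_q -/xi => sgp.
  rewrite QE derivZ hornerZ mulrCA pmulr_rlt0 ?invr_gt0 ?ltr0n ?fact_gt0 //.
  by rewrite /sg -(subnSK ltim) exprS mulN1r mulNr oppr_lt0.
have Qxi : Q.[xi] = 0 by rewrite QE horner_prod_XsubC_root ?mem_nth.
(* P(x) = L(x) A - x Q(x) L'(x); with - L' >= C L the second term outweighs
   the first by at least L(x). *)
pose A := x * Q^`().[x] + (- alpha - 1 + x) * Q.[x].
pose K := - x * (sg * Q.[x]).
have K_gt0 : 0 < K by rewrite /K mulr_gt0 // oppr_gt0.
pose C := (`|A| + 1) / K.
have C_ge0 : 0 <= C by rewrite /C divr_ge0 ?addr_ge0 // ltW.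
have [N NP] := laguerre_logderiv_unbounded a_gt x_lt0 C_ge0.
exists N => n /NP; rewrite qE -/xi.
set P := xlaguerre3 _ _ _.
have [Pnz size_ng _ ng_loc _] := xlaguerre3_roots m n alpha_gt alpha_lt.
rewrite -/P -/Q qE in Pnz size_ng ng_loc.
have PE := xlaguerre3E alpha m n; rewrite -/P -/Q in PE.
set L := laguerre _ n in PE * => CL.
have Px y : P.[y] = y * (L.[y] * Q^`().[y] - L^`().[y] * Q.[y])
    + (- alpha - 1 + y) * (L.[y] * Q.[y]).
  by rewrite PE !(hornerE, hornerM, hornerD, hornerN, hornerX, hornerC).
have sgPx : sg * P.[x] < 0.
  have L_gt0 : 0 < L.[x] by rewrite laguerre_gt0 // ltW.
  have -> : sg * P.[x] = L.[x] * (sg * A) - K * (- L^`().[x]).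
    by rewrite Px /A /K; ring.
  have sgA : sg * A <= `|A|.
    apply: le_trans (ler_norm _) _.
    by rewrite normrM normrX normrN1 expr1n mul1r.
  have : L.[x] * (`|A| + 1) <= K * - L^`().[x].
    have -> : L.[x] * (`|A| + 1) = K * (C * L.[x]).
      by rewrite /C; field; rewrite gt_eqF.
    by rewrite ler_pM2l.
  have : L.[x] * (sg * A) <= L.[x] * `|A| by rewrite ler_pM2l.
  by lra.
have sgPxi : 0 < sg * P.[xi].
  have -> : sg * P.[xi] = L.[xi] * (xi * (sg * Q^`().[xi])).
    by rewrite Px Qxi; ring.
  by rewrite mulr_gt0 ?nmulr_rgt0 // laguerre_gt0 // ltW.
have sgPP : P.[x] * P.[xi] < 0.
  have := sgPx; rewrite -(pmulr_llt0 _ sgPxi) mulrACA -exprD addnn -mul2n.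
  by rewrite exprM sqrrN !expr1n mul1r.
have [z + rz] := poly_ivtoo (ltW x_lt) sgPP; rewrite in_itv /= => /andP[xz zxi].
have : z \in neg_roots P.
  rewrite mem_filter (lt_trans zxi) //= -(roots_on_rootsR Pnz) ?in_itv //=.
case/(nthP 0) => j; rewrite size_ng => ltjm zE.
(* The interlacing leaves only the index i for a root between x and xi. *)
suff -> : i = j by rewrite zE zxi (lt_trans x_gt).
have [lt_j gt_j] := ng_loc j ltjm.
have le_q k l : (k <= l)%N -> (l < m)%N -> nth 0 q k <= nth 0 q l.
  move=> lekl ltlm; rewrite lt_sorted_leq_nth ?inE ?size_q //.
  exact: leq_ltn_trans ltlm.
case: (ltngtP i j) => // [ltij|ltji].
- have j_gt0 := leq_ltn_trans (leq0n i) ltij.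
  have le_prev : nth 0 q i <= nth 0 q j.-1.
    apply: le_q; first by rewrite -ltnS prednK.
    exact: leq_ltn_trans (leq_pred j) ltjm.
  have := lt_trans (le_lt_trans le_prev (gt_j j_gt0)) _.
  by rewrite zE => /(_ _ zxi); rewrite ltxx.
- have i_gt0 := leq_ltn_trans (leq0n j) ltji.
  have le_prev : nth 0 q j <= nth 0 q i.-1.
    apply: le_q; first by rewrite -ltnS prednK.
    exact: leq_ltn_trans (leq_pred i) ltim.
  have := lt_trans (lt_le_trans lt_j le_prev) (lt_trans (x_take i_gt0) xz).
  by rewrite zE ltxx.
Qed.

Theorem theorem5p6 (R : realType) (m : nat) (alpha : R)
    (m_gt0 : (0 < m)%N) (alpha_gtN1 : -1 < alpha) (alpha_lt0 : alpha < 0) :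
  let P (k : nat) : {poly R} := xlaguerre3 alpha m (m + k) in
  let Q : {poly R} := laguerre (- alpha - 1) m \Po (- 'X) in
  (* the root lists have the expected lengths, so that the entries below are
     genuine roots and not default values *)
  [/\ size (rootsR Q) = m,
      (forall k : nat, (0 < k)%N ->
         size (neg_roots (P k)) = m /\ size (pos_roots (P k)) = k),
      (forall i : nat, (i < m)%N ->
         (fun k : nat => nth 0 (neg_roots (P k)) i) @ \oo
           --> nth 0 (rootsR Q) i)
    & (fun k : nat => nth 0 (pos_roots (P k)) 0) @ \oo --> (0 : R)].
Proof.
move=> P Q; have b_gt : -1 < - alpha - 1 by lra.
have Pk k : (0 < k)%N -> P k = xlaguerre3 alpha m (m + k.-1.+1).
  by move=> k_gt0; rewrite /P prednK.
split.
- have [q [size_q _ _ _ qE]] := reflected_laguerre_roots m b_gt.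
  by rewrite /Q qE.
- move=> k k_gt0; rewrite Pk //.
  have [_ -> -> _ _] := xlaguerre3_roots m k.-1 alpha_gtN1 alpha_lt0.
  by rewrite prednK.
- move=> i ltim; apply/cvgrPdist_lt => eps eps_gt0.
  have [N NP] := xlaguerre3_neg_root_near alpha_gtN1 alpha_lt0 ltim eps_gt0.
  exists N.+1 => // k /= ltNk; have k_gt0 := leq_ltn_trans (leq0n N) ltNk.
  have leNk : (N <= k.-1)%N by rewrite -ltnS prednK.
  rewrite Pk //; have /andP[lt1 lt2] := NP k.-1 leNk; rewrite -/Q in lt1 lt2.
  by rewrite gtr0_norm ?subr_gt0 // ltrBlDr -ltrBlDl.
apply/cvgrPdist_lt => eps eps_gt0.
pose C := (alpha + 2) * (alpha + 3).
exists (Num.truncn (C / eps)).+2 => // k /= ltNk.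
have k_gt1 : (1 < k)%N by apply: leq_trans ltNk.
rewrite Pk ?(ltnW k_gt1) //.
have [_ _ _ _] := xlaguerre3_roots m k.-1 alpha_gtN1 alpha_lt0.
have k1 : (0 < k.-1)%N by rewrite -ltnS prednK // ltnW.
case/(_ k1)/andP => gt0 le_C; rewrite sub0r normrN gtr0_norm //.
apply: le_lt_trans le_C _.
rewrite ltr_pdivrMr ?ltr0n // [eps * _]mulrC -ltr_pdivrMr // -/C.
apply: lt_le_trans (truncnS_gt (C / eps)) _; rewrite ler_nat -ltnS prednK //.
exact: ltnW.
Qed.
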